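(* Let $f$ be a non-negative, real analytic function on a calibrated manifold $(X,\phi)$ (with $X$ a real analytic manifold), and consider the real analytic subvariety $Z=\{x\in X:f(x)=0\}$. If $f$ is strictly $\phi$-plurisubharmonic at the points of $Z$, then each stratum of $Z$ is $\phi$-free.
   Context: A calibrated manifold $(X,\phi)$ of degree $p\ge 1$ is a smooth riemannian manifold $X$ together with a closed smooth $p$-form $\phi$ such that $\phi(\xi)\le 1$ for every unit simple tangent $p$-vector $\xi$ on $X$. $G_x(\phi)$ denotes the set of unit simple $p$-vectors $\xi$ at $x$ with $\phi(\xi)=1$ ($\phi$-planes); each $\xi$ determines a $p$-dimensional subspace $\mathrm{span}\,\xi\subset T_xX$. For $f\in C^\infty(X)$, the $\phi$-Hessian of $f$ is the $p$-form $\mathcal H^\phi(f)(v_1,\dots,v_p)=\sum_{i=1}^p\phi(v_1,\dots,\nabla_{v_i}(\nabla f),\dots,v_p)$ ($\nabla_{v_i}(\nabla f)$ in the $i$-th slot, $\nabla$ the Levi-Civita connection). $f$ is strictly $\phi$-plurisubharmonic at $x$ if $\mathcal H^\phi(f)(\xi)>0$ for all $\xi\in G_x(\phi)$. A stratum of $Z$ is a member of a stratification of the real analytic set $Z$ into (locally closed) smooth submanifolds of $X$. A submanifold $M\subset X$ is $\phi$-free if there is no $x\in M$ and $\xi\in G_x(\phi)$ with $\mathrm{span}\,\xi\subset T_xM$. *)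

(* Defs.v *)
From HB Require Import structures.
From mathcomp Require Import all_boot all_order all_algebra.
From mathcomp Require Import all_classical all_reals all_analysis.
Import Order.TTheory GRing.Theory Num.Theory.
Import numFieldNormedType.Exports.

Set Implicit Arguments.
Unset Strict Implicit.
Unset Printing Implicit Defensive.

Local Open Scope classical_set_scope.
Local Open Scope ring_scope.

(* A function is of class C^(k+1) on U when it is differentiable on U and its
   differential, i.e. each directional derivative, is of class C^k.  The set U
   is meant to be open. *)
Fixpoint Ck_on (R : realType) (V W : normedModType R) (k : nat) (U : set V)
    (f : V -> W) : Prop :=
  if k is k'.+1 then
    (forall x, U x -> differentiable f x) /\
    (forall v : V, Ck_on k' U (fun x => 'D_v f x))
  else forall x, U x -> {for x, continuous f}.

Definition smooth_on (R : realType) (V W : normedModType R) (U : set V)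
    (f : V -> W) : Prop :=
  forall k, Ck_on k U f.

(* The Taylor series of f at a, grouped by homogeneous degree:
   (D_h^k f)(a) / k! = \sum_(|alpha| = k) (d^alpha f)(a) / alpha! * h^alpha. *)
Definition taylor_term (R : realType) (V W : normedModType R) (f : V -> W)
    (a h : V) (k : nat) : W :=
  (k`!%:R)^-1 *: iter k (fun (F : V -> W) x => 'D_h F x) f a.

Definition analytic_on (R : realType) (V W : normedModType R) (U : set V)
    (f : V -> W) : Prop :=
  smooth_on U f /\
  forall a, U a -> exists2 r : R, 0 < r &
    forall h : V, `|h| < r -> series (taylor_term f a h) @ \oo --> f (a + h).

Record chart (R : realType) (n : nat) (X : topologicalType) := Chart {
  chart_fun :> X -> 'rV[R]_n;
  chart_dom : set X;
  chart_inv : 'rV[R]_n -> X;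
  chart_dom_open : open chart_dom;
  chart_img_open : open (chart_fun @` chart_dom);
  chart_funK : forall x, chart_dom x -> chart_inv (chart_fun x) = x;
  chart_continuous : forall x, chart_dom x -> {for x, continuous chart_fun};
  chart_inv_continuous :
    forall y, (chart_fun @` chart_dom) y -> {for y, continuous chart_inv}
}.

Definition chart_img (R : realType) (n : nat) (X : topologicalType)
    (c : chart R n X) : set 'rV[R]_n :=
  c @` chart_dom c.

Definition transition_dom (R : realType) (n : nat) (X : topologicalType)
    (c c' : chart R n X) : set 'rV[R]_n :=
  c @` (chart_dom c `&` chart_dom c').

Definition transition (R : realType) (n : nat) (X : topologicalType)
    (c c' : chart R n X) : 'rV[R]_n -> 'rV[R]_n :=
  c' \o chart_inv c.

(* A preferred chart [chart_at x] around each point is part of the data: it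
   identifies the tangent space at x with 'rV[R]_n. *)
Record analyticManifold (R : realType) (n : nat) := AnalyticManifold {
  mfd_space :> topologicalType;
  mfd_hausdorff : hausdorff_space mfd_space;
  mfd_second_countable : @second_countable mfd_space;
  atlas : set (chart R n mfd_space);
  chart_at : mfd_space -> chart R n mfd_space;
  chart_at_atlas : forall x, atlas (chart_at x);
  chart_at_dom : forall x, chart_dom (chart_at x) x;
  atlas_analytic : forall c c', atlas c -> atlas c' ->
    analytic_on (transition_dom c c') (transition c c')
}.

Section Manifold.
Variables (R : realType) (n : nat) (X : analyticManifold R n).
Implicit Types (c : chart R n X) (x : X).

Definition analytic_fun (f : X -> R) : Prop :=
  forall c, atlas c -> analytic_on (chart_img c) (f \o chart_inv c).

(* A tangent vector at x is a row vector, read in the chart [chart_at x].  With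
   x = chart_inv c y, the rows of [frame_at c y] are the tangent vectors at x
   of the coordinate frame of c, and v *m [coords_at c y] is the vector of
   coordinates in c of the tangent vector v at x. *)
Definition frame_at c (y : 'rV[R]_n) : 'M[R]_n :=
  jacobian (transition c (chart_at (chart_inv c y))) y.

Definition coords_at c (y : 'rV[R]_n) : 'M[R]_n :=
  let x := chart_inv c y in
  jacobian (transition (chart_at x) c) (chart_at x x).

(* The metric is given by its Gram matrix on each tangent space. *)
Definition metric_in c (g : X -> 'M[R]_n) (y : 'rV[R]_n) : 'M[R]_n :=
  frame_at c y *m g (chart_inv c y) *m (frame_at c y)^T.

Definition field_in c (V : X -> 'rV[R]_n) (y : 'rV[R]_n) : 'rV[R]_n :=
  V (chart_inv c y) *m coords_at c y.

(* The arguments of a p-form are the rows of a matrix. *)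
Definition form_in p c (phi : X -> 'M[R]_(p, n) -> R) (A : 'M[R]_(p, n))
    (y : 'rV[R]_n) : R :=
  phi (chart_inv c y) (A *m frame_at c y).

Definition inner (g : X -> 'M[R]_n) x (u v : 'rV[R]_n) : R :=
  (u *m g x *m v^T) 0 0.

Definition riemannian_metric (g : X -> 'M[R]_n) : Prop :=
  [/\ forall x, (g x)^T = g x,
      forall x (v : 'rV[R]_n), v != 0 -> 0 < inner g x v v
    & forall c, atlas c -> smooth_on (chart_img c) (metric_in c g)].

Definition alternating_form p (w : 'M[R]_(p, n) -> R) : Prop :=
  (forall (A B C : 'M[R]_(p, n)) (i : 'I_p) (a b : R),
     row i A = a *: row i B + b *: row i C ->
     row' i B = row' i A -> row' i C = row' i A ->
     w A = a * w B + b * w C) /\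
  (forall (A : 'M[R]_(p, n)) (i j : 'I_p),
     i != j -> row i A = row j A -> w A = 0).

Definition smooth_form p (phi : X -> 'M[R]_(p, n) -> R) : Prop :=
  (forall x, alternating_form (phi x)) /\
  (forall c (A : 'M[R]_(p, n)), atlas c ->
     smooth_on (chart_img c) (form_in c phi A)).

(* d phi (v_0, ..., v_p) is computed on vectors constant in the chart c. *)
Definition closed_form p (phi : X -> 'M[R]_(p, n) -> R) : Prop :=
  forall c (y : 'rV[R]_n) (A : 'M[R]_(p.+1, n)), atlas c -> chart_img c y ->
    \sum_(i < p.+1) (-1) ^+ i *
      'D_(row i A) (form_in c phi (row' i A)) y = 0.

(* A simple p-vector v_1 /\ ... /\ v_p at x is represented by the matrix xi
   with rows v_i: its squared norm is the Gram determinant of the v_i, and its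
   span is the row space of xi. *)
Definition unit_simple p (g : X -> 'M[R]_n) x (xi : 'M[R]_(p, n)) : Prop :=
  \det (xi *m g x *m xi^T) = 1.

Definition comass_le1 p (g : X -> 'M[R]_n) (phi : X -> 'M[R]_(p, n) -> R) :
    Prop :=
  forall x (xi : 'M[R]_(p, n)), unit_simple g x xi -> phi x xi <= 1.

Definition gradient (g : X -> 'M[R]_n) (f : X -> R) x : 'rV[R]_n :=
  (\row_i 'D_(delta_mx 0 i) (f \o chart_inv (chart_at x)) (chart_at x x))
    *m invmx (g x).

Definition christoffel (g : X -> 'M[R]_n) c (y : 'rV[R]_n) (i j k : 'I_n) : R :=
  2^-1 * \sum_l invmx (metric_in c g y) k l *
    ('D_(delta_mx 0 i) (fun z => metric_in c g z j l) y
     + 'D_(delta_mx 0 j) (fun z => metric_in c g z i l) y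
     - 'D_(delta_mx 0 l) (fun z => metric_in c g z i j) y).

(* The Levi-Civita covariant derivative of the vector field V along the tangent
   vector v at x, in the chart [chart_at x]. *)
Definition levi_civita (g : X -> 'M[R]_n) x (v : 'rV[R]_n) (V : X -> 'rV[R]_n) :
    'rV[R]_n :=
  let c := chart_at x in
  'D_v (field_in c V) (c x) +
  \row_k \sum_i \sum_j christoffel g c (c x) i j k * v 0 i * V x 0 j.

Definition compatible_chart c : Prop :=
  forall c', atlas c' ->
    smooth_on (transition_dom c c') (transition c c') /\
    smooth_on (transition_dom c' c) (transition c' c).

(* Embedded submanifolds, through slice charts; the dimension d is locally
   constant on M. *)
Definition submanifold (M : set X) : Prop :=
  forall x, M x -> exists (d : nat) (c : chart R n X),
    [/\ (d <= n)%N, compatible_chart c, chart_dom c x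
      & forall z, chart_dom c z ->
          (M z <-> forall i : 'I_n, (d <= i)%N -> c z 0 i = 0)].

(* T_x M is the set of velocities at x of the smooth curves in M. *)
Definition tangent_space (M : set X) x : set 'rV[R]_n :=
  [set v | exists (gamma : R -> X) (e : R),
     [/\ 0 < e, gamma 0 = x,
         forall t, `|t| < e -> M (gamma t) /\ chart_dom (chart_at x) (gamma t),
         smooth_on [set t : R | `|t| < e] (chart_at x \o gamma)
       & 'D_1 (chart_at x \o gamma) 0 = v]].

Definition stratification (Z : set X) (S : set (set X)) : Prop :=
  [/\ \bigcup_(M in S) M = Z,
      trivIset S id,
      forall x, exists2 U, nbhs x U & finite_set [set M | S M /\ M `&` U !=set0]
    & forall M, S M -> submanifold M].

End Manifold.

Record calibratedManifold (R : realType) (n p : nat) := CalibratedManifold {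
  cal_mfd :> analyticManifold R n;
  metric : cal_mfd -> 'M[R]_n;
  calib : cal_mfd -> 'M[R]_(p, n) -> R;
  cal_riemannian : riemannian_metric metric;
  cal_smooth : smooth_form calib;
  cal_closed : closed_form calib;
  cal_comass : comass_le1 metric calib
}.

Section Calibration.
Variables (R : realType) (n p : nat) (X : calibratedManifold R n p).

Definition phi_planes (x : X) : set 'M[R]_(p, n) :=
  [set xi | unit_simple (@metric R n p X) x xi /\ calib x xi = 1].

Definition phi_hessian (f : X -> R) (x : X) (xi : 'M[R]_(p, n)) : R :=
  let g := @metric R n p X in
  \sum_(i < p) calib x (\matrix_(j < p)
    if j == i then levi_civita g x (row i xi) (gradient g f) else row j xi).

Definition strictly_phi_psh (f : X -> R) (x : X) : Prop :=
  forall xi, phi_planes x xi -> 0 < phi_hessian f x xi.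

Definition phi_free (M : set X) : Prop :=
  ~ exists (x : X) (xi : 'M[R]_(p, n)),
      [/\ M x, phi_planes x xi
        & forall v : 'rV[R]_n, (v <= xi)%MS -> tangent_space M x v].

End Calibration.

(* Main.v *)
Require Import Defs.
From mathcomp Require Import all_boot all_order all_algebra.
From mathcomp Require Import all_classical all_reals all_analysis.
Local Open Scope classical_set_scope.
Local Open Scope ring_scope.
Import Order.TTheory GRing.Theory Num.Theory.
Import numFieldNormedType.Exports.

(** Since [f] is non-negative, every point of [Z = {f = 0}] is a minimum of [f],
    so the gradient of [f] vanishes identically on [Z].  If a stratum [M] had a
    [phi]-plane [xi] in its tangent space at [x], each row [v] of [xi] would be
    the velocity at [x] of a curve running in [M], hence in [Z]; the gradient is
    zero along that curve, so its covariant derivative along [v] is zero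
    ([levi_civita_gradient_eq0]).  Every summand of the [phi]-Hessian of [f] on
    [xi] is then the value of [phi] on a matrix with a zero row, so that the
    Hessian is zero on [xi], against strict plurisubharmonicity.

    The vanishing of the covariant derivative needs care because the gradient at
    a point [z] is expressed in a chart that depends on [z].  Read in the fixed
    chart [c] around [x], it is the field [y |-> dh(y) *m G(y)^-1], with
    [h = f o c^-1] and [G] the Gram matrix of the metric in [c]
    ([field_in_gradient]).  Its factor [dh] vanishes at [c x] together with its
    derivative along [v] ([derive_along_zero_curve]), and its factor [G^-1] is
    continuous; so the product has derivative zero along [v]
    ([is_derive_mul_vanish]), and so has the gradient.  The Christoffel term is
    zero because the gradient is zero at [x]. *)

(** * Differential calculus and matrices *)

Section Calculus.
Context {R : realType}.

(** Where [u] vanishes, the difference quotient of [u * b] is the one of [u] times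
    a value of [b] at a nearby point: continuity of [b] suffices, and no
    derivative of [b], here an inverse metric, has to be computed. *)
Lemma is_derive_mul_vanish {V : normedModType R} (u b : V -> R) (y v : V) :
  u y = 0 -> is_derive y v u 0 -> {for y, continuous b} ->
  is_derive y v (u \* b) 0.
Proof.
move=> uy0 [du du0] cb.
have lineC : (h *: v + y) @[h --> (0 : R)^'] --> y.
  rewrite -[X in _ --> X]add0r -(scale0r v); apply: cvgD; last exact: cvg_cst.
  apply: cvgZ; last exact: cvg_cst.
  exact: nbhs_dnbhs.
have q0 : h^-1 *: (u (h *: v + y) - u y) @[h --> (0 : R)^'] --> (0 : R).
  by rewrite -[X in _ --> X]du0; exact: du.
have : h^-1 *: ((u \* b) (h *: v + y) - (u \* b) y) @[h --> (0 : R)^'] --> (0 : R).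
  rewrite -[X in _ --> X](mul0r (b y)).
  have -> : (fun h : R => h^-1 *: ((u \* b) (h *: v + y) - (u \* b) y)) =
    (fun h : R => h^-1 *: (u (h *: v + y) - u y)) \* (fun h : R => b (h *: v + y)).
    by apply: funext => h /=; rewrite uy0 mul0r !subr0 scalerAl.
  by apply: (cvgM q0); exact: cvg_comp lineC cb.
move=> lim0; apply: DeriveDef; first by apply/cvg_ex; exists 0.
exact: cvg_lim lim0.
Qed.

(** At a minimum the derivative along [v] is the limit of non-negative quotients,
    and so is the derivative along [- v], which is its opposite. *)
Lemma derive_at_min {V : normedModType R} (h : V -> R) (y v : V) :
  differentiable h y -> (forall w, h y <= h w) -> 'D_v h y = 0.
Proof.
move=> dh hmin.
have ge0 w : 0 <= 'D_w h y.
  have /cvg_dnbhs_at_right cvD : derivable h y w by exact: diff_derivable.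
  change (0 <= lim (h0^-1 *: ((h \o shift y) (h0 *: w) - h y) @[h0 --> (0 : R)^'])).
  rewrite -(cvg_lim (@norm_hausdorff _ _) cvD).
  apply: limr_ge; first by apply/cvg_ex; exists ('D_w h y).
  near=> t; apply: mulr_ge0; last by rewrite subr_ge0 hmin.
  by rewrite invr_ge0; near: t; exact: nbhs_right_ge.
apply/eqP; rewrite eq_le ge0 andbT -oppr_ge0.
have := ge0 (- v); rewrite !deriveE//.
by rewrite linearN.
Unshelve. all: by end_near. Qed.

(** The chain rule turns the derivative of [a] along the velocity of [gamma] into
    the derivative of the locally constant function [a o gamma]. *)
Lemma derive_along_zero_curve {V : normedModType R} (a : V -> R) (gamma : R -> V) :
  differentiable a (gamma 0) -> differentiable gamma 0 ->
  (\forall t \near (0 : R), a (gamma t) = 0) -> 'D_('D_1 gamma 0) a (gamma 0) = 0.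
Proof.
move=> da dg a0.
transitivity ('D_1 (a \o gamma) 0).
  rewrite (deriveE _ da) (deriveE _ dg) deriveE; last exact: differentiable_comp.
  by rewrite (diff_comp dg da).
by rewrite (@near_eq_derive _ _ _ _ (cst 0))//; exact: derive_cst.
Qed.

(** Cramer's rule: near a point where [A] is invertible, the entries of its
    inverse are quotients of polynomials in the entries of [A]. *)
Lemma cvg_invmx {T : topologicalType} {n : nat} (A : T -> 'M[R]_n) (t : T) :
  (forall i j, {for t, continuous (fun x => A x i j)}) -> A t \in unitmx ->
  forall i j, {for t, continuous (fun x => invmx (A x) i j)}.
Proof.
move=> cA unitA.
have cdet m (B : T -> 'M[R]_m) :
  (forall i j, {for t, continuous (fun x => B x i j)}) ->
  {for t, continuous (fun x => \det (B x))}.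
  move=> cB; apply: cvg_big; first exact: add_continuous.
  move=> s _; apply: cvgM; first exact: cvg_cst.
  apply: cvg_big; first exact: mul_continuous.
  by move=> i _; exact: cB.
move=> i j.
have det0 : \det (A t) != 0 by rewrite -unitfE.
have nearU : \forall x \near t, (\det (A x))^-1 * (\adj (A x)) i j = invmx (A x) i j.
  have : \forall x \near t, \det (A x) != 0.
    have := cdet _ _ cA; rewrite /continuous_at => /cvgr_neq0; exact.
  by apply: filterS => x dx; rewrite /invmx unitmxE unitfE dx !mxE.
apply: (cvg_trans (near_eq_cvg nearU)).
rewrite /= -(nbhs_singleton nearU).
apply: cvgM; first exact: (cvgV det0 (cdet _ _ cA)).
have -> : (fun x => \adj (A x) i j) =
  (fun x => (-1) ^+ (j + i) * \det (row' j (col' i (A x)))).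
  by apply: funext => x; rewrite mxE.
rewrite /= [X in _ --> X]mxE; apply: cvgM; first exact: cvg_cst.
apply: cdet => k l.
have -> : (fun x => row' j (col' i (A x)) k l) = (fun x => A x (lift j k) (lift i l)).
  by apply: funext => x; rewrite !mxE.
exact: cA.
Qed.

Definition partials {n} (h : 'rV[R]_n -> R) (y : 'rV[R]_n) : 'rV[R]_n :=
  \row_i 'D_(delta_mx 0 i) h y.

Lemma derive_partials n (h : 'rV[R]_n -> R) (y v : 'rV[R]_n) :
  differentiable h y -> 'D_v h y = (v *m (partials h y)^T) 0 0.
Proof.
move=> dh; rewrite deriveE// {1}(row_sum_delta v) linear_sum mxE.
by apply: eq_bigr => i _; rewrite linearZ !mxE deriveE.
Qed.

(** With row vectors the chain rule reads [v *m jacobian T y] on tangent vectors,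
    so covectors such as [partials h] are multiplied by the transpose. *)
Lemma partials_comp m n (h : 'rV[R]_n -> R) (T : 'rV[R]_m -> 'rV[R]_n)
    (y : 'rV[R]_m) : differentiable T y -> differentiable h (T y) ->
  partials (h \o T) y = partials h (T y) *m (jacobian T y)^T.
Proof.
move=> dT dh; apply/rowP => i; rewrite [LHS]mxE deriveE; last exact: differentiable_comp.
rewrite (diff_comp dT dh)/= -(deriveE _ dT) (deriveEjacobian _ dT) -(deriveE _ dh).
rewrite (derive_partials _ _ _ _ dh) -mulmxA -rowE mxE.
by rewrite -[in RHS](trmxK (partials _ _)) -trmx_mul [RHS]mxE.
Qed.

(** How the inverse of a Gram matrix changes when [F] changes the frame and [C]
    is the inverse change of coordinates. *)
Lemma invmx_congr n (F C G : 'M[R]_n) : F *m C = 1%:M -> G \in unitmx ->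
  invmx (F *m G *m F^T) = C^T *m invmx G *m C.
Proof.
move=> FC uG; have [uF uC] := mulmx1_unit FC.
have CF := mulmx1C FC.
have MN : (F *m G *m F^T) *m (C^T *m invmx G *m C) = 1%:M.
  by rewrite !mulmxA -(mulmxA _ F^T) -trmx_mul CF trmx1 mulmx1 mulmxK.
have [uM _] := mulmx1_unit MN.
by rewrite -[LHS]mulmx1 -MN mulKmx.
Qed.

Lemma posdef_unitmx n (G : 'M[R]_n) :
  (forall v : 'rV_n, v != 0 -> 0 < (v *m G *m v^T) 0 0) -> G \in unitmx.
Proof.
move=> pos; rewrite -row_free_unit; apply: inj_row_free => v vG0.
apply/eqP; apply: contraT => /pos.
by rewrite vG0 mul0mx mxE ltxx.
Qed.
End Calculus.

(** * The gradient read in a chart *)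

Section Charts.
Context {R : realType} {n : nat} {X : analyticManifold R n}.
Implicit Types (c : chart R n X) (f : X -> R) (g : X -> 'M[R]_n) (z : X).

Lemma transitionE c c' z : chart_dom c z -> transition c c' (c z) = c' z.
Proof. by move=> cz; rewrite /transition /= chart_funK. Qed.

Lemma near_chart_inv c (U : set X) z : open U -> chart_dom c z -> U z ->
  \forall y \near c z, U (chart_inv c y).
Proof.
move=> oU cz Uz.
apply: (chart_inv_continuous (c := c)); first by exists z.
by rewrite chart_funK//; exact: open_nbhs_nbhs.
Qed.

Lemma near_chart_img c z : chart_dom c z -> \forall y \near c z, chart_img c y.
Proof.
by move=> cz; apply: open_nbhs_nbhs; split; [exact: chart_img_open|exists z].
Qed.

Lemma differentiable_transition c c' z : atlas c -> atlas c' ->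
  chart_dom c z -> chart_dom c' z -> differentiable (transition c c') (c z).
Proof.
move=> Ac Ac' cz c'z.
have [/(_ 1%N)[+ _] _] := atlas_analytic Ac Ac'; apply.
by exists z.
Qed.

(** The differential of [f] transforms contravariantly to tangent vectors: near
    [c' z] the reading of [f] in [c'] is its reading in [c] composed with the
    transition from [c'] to [c]. *)
Lemma partials_transition c c' f z : atlas c -> atlas c' ->
  chart_dom c z -> chart_dom c' z ->
  differentiable (f \o chart_inv c) (c z) ->
  partials (f \o chart_inv c') (c' z) =
  partials (f \o chart_inv c) (c z) *m (jacobian (transition c' c) (c' z))^T.
Proof.
move=> Ac Ac' cz c'z df.
have zE := transitionE c' c z c'z.
rewrite -{1}zE -partials_comp; last 2 first.
- exact: differentiable_transition.
- by rewrite zE.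
apply/rowP => i; rewrite !mxE; apply: near_eq_derive.
have := near_chart_inv c' _ z (chart_dom_open c) c'z cz.
by apply: filterS => w cw /=; rewrite /transition /= chart_funK.
Qed.

(** The two transitions between [c] and [c'] are mutually inverse near [c z], so
    the chain rule makes their Jacobians inverse matrices. *)
Lemma jacobian_transitionK c c' z : atlas c -> atlas c' ->
  chart_dom c z -> chart_dom c' z ->
  jacobian (transition c c') (c z) *m jacobian (transition c' c) (c' z) = 1%:M.
Proof.
move=> Ac Ac' cz c'z.
have zE := transitionE c c' z cz.
have dT := differentiable_transition c c' z Ac Ac' cz c'z.
have dT' := differentiable_transition c' c z Ac' Ac c'z cz.
apply/row_matrixP => i; rewrite !rowE mulmx1 mulmxA.
rewrite -(deriveEjacobian _ dT) -(deriveEjacobian _ dT').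
transitivity ('D_(delta_mx 0 i) (transition c' c \o transition c c') (c z)).
  rewrite -zE in dT' *.
  rewrite [RHS]deriveE; last exact: differentiable_comp.
  by rewrite (diff_comp dT dT') (deriveE _ dT') (deriveE _ dT).
rewrite -[RHS](derive_id (c z)); apply: near_eq_derive.
apply: filterS2 (near_chart_img c z cz) (near_chart_inv c _ z (chart_dom_open c') cz c'z).
by move=> _ [w cw <-]; rewrite chart_funK// /transition /= => c'w; rewrite !chart_funK.
Qed.

(** The preferred chart at [z], in which the gradient is defined, disappears: by
    [partials_transition] and [invmx_congr] its Jacobians cancel, which leaves
    the usual coordinate formula, in the chart [c] alone. *)
Lemma field_in_gradient g f c z :
  atlas c -> chart_dom c z -> g z \in unitmx ->
  differentiable (f \o chart_inv c) (c z) ->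
  field_in c (gradient g f) (c z) =
  partials (f \o chart_inv c) (c z) *m invmx (metric_in c g (c z)).
Proof.
move=> Ac cz uG df.
have Az := chart_at_atlas z; have zz := chart_at_dom z.
rewrite /field_in /coords_at /metric_in /frame_at chart_funK// /gradient.
rewrite -/(partials _ _) (partials_transition c _ f z Ac Az cz zz df).
rewrite (invmx_congr _ _ _ _ (jacobian_transitionK c _ z Ac Az cz zz) uG).
by rewrite !mulmxA.
Qed.

(** * The covariant derivative of the gradient along the zero set *)

(** The gradient of [f] is zero along the curve with velocity [v] that lies in the
    zero set.  The gradient is not composed with this curve directly: its reading
    in the chart is split into the differential of [f], to which the chain rule
    applies, and an inverse metric that is known to be continuous. *)
Lemma levi_civita_gradient_eq0 g f x v :
  riemannian_metric g -> analytic_fun f ->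
  (forall z, 0 <= f z) -> tangent_space [set z | f z = 0] x v ->
  levi_civita g x v (gradient g f) = 0.
Proof.
move=> [_ gpos gsmooth] fa f0 [gamma [e [e0 gam0 gamZ gamS gamD]]].
have fx : f x = 0 by rewrite -gam0; apply: (gamZ 0 _).1; rewrite normr0.
set c := chart_at x.
have Ac : atlas c := chart_at_atlas x.
have cx : chart_dom c x := chart_at_dom x.
set h := f \o chart_inv c.
have [fS _] := fa c Ac.
have dh y : chart_img c y -> differentiable h y by have [+ _] := fS 1%N; apply.
have critical z : chart_dom c z -> f z = 0 -> partials h (c z) = 0.
  move=> cz fz; apply/rowP => i; rewrite !mxE; apply: derive_at_min.
    by apply: dh; exists z.
  by move=> w; rewrite /h /= chart_funK// fz.
have uG z : g z \in unitmx by apply: posdef_unitmx => v0; exact: gpos.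
set B := metric_in c g.
have cB i j : {for c x, continuous (fun y => invmx (B y) i j)}.
  apply: cvg_invmx.
  - move=> k l; apply: (@continuous_comp _ _ _ B (fun A => A k l) _ _
      (@coord_continuous _ _ _ k l (B (c x)))).
    by have := gsmooth c Ac 0%N; apply; exists x.
  - rewrite /B /metric_in /frame_at chart_funK// !unitmx_mul unitmx_tr uG.
    have [-> _] := mulmx1_unit (jacobian_transitionK c _ x Ac Ac cx cx).
    by [].
have dP i : is_derive (c x) v (fun y => partials h y 0 i) 0.
  have dPi : differentiable (fun y => partials h y 0 i) (c x).
    have -> : (fun y => partials h y 0 i) = 'D_(delta_mx 0 i) h.
      by apply: funext => y; rewrite mxE.
    by have [_ /(_ (delta_mx 0 i)) [+ _]] := fS 2%N; apply; exists x.
  apply: DeriveDef; first exact: diff_derivable.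
  have cgam0 : (c \o gamma) 0 = c x by rewrite /= gam0.
  rewrite -gamD -cgam0; apply: derive_along_zero_curve.
  - by rewrite cgam0.
  - by have [+ _] := gamS 1%N; apply; rewrite /= normr0.
  - apply: filterS (nbhs0_lt e0) => t /gamZ [fz cz].
    by rewrite /= critical// mxE.
have field_comp j : is_derive (c x) v (fun y => field_in c (gradient g f) y 0 j) 0.
  have dS : is_derive (c x) v
      (\sum_(i < n) ((fun y => partials h y 0 i) \* (fun y => invmx (B y) i j)))
      (\sum_(i < n) 0).
    apply: is_derive_sum => i; apply: is_derive_mul_vanish => //.
    by rewrite critical// mxE.
  (* The coordinate formula holds on the whole chart, which is enough to
     differentiate it. *)
  rewrite big1_eq in dS; apply: near_eq_is_derive dS.
  apply: filterS (near_chart_img c x cx) => _ [z cz <-].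
  rewrite field_in_gradient//; last by apply: dh; exists z.
  by rewrite mxE fct_sumE.
have dF : derivable (field_in c (gradient g f)) (c x) v.
  by apply/derivable_mxP => i j; rewrite ord1.
have gx0 : gradient g f x = 0.
  by rewrite /gradient -/(partials _ _) critical// mul0mx.
rewrite /levi_civita -/c derive_mx//; apply/rowP => k; rewrite !mxE gx0.
rewrite big1 => [|i _]; last by rewrite big1// => j _; rewrite mxE mulr0.
by rewrite addr0 derive_val.
Qed.

End Charts.

(** * Freeness of the strata *)

Lemma alternating_row0 {R : realType} {n p : nat} (w : 'M[R]_(p, n) -> R)
    (A : 'M[R]_(p, n)) (i : 'I_p) :
  alternating_form w -> row i A = 0 -> w A = 0.
Proof.
move=> [wlin _] Ai0.
have -> // := wlin A A A i 0 0; first by rewrite !mul0r addr0.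
by rewrite Ai0 !scale0r addr0.
Qed.

Theorem proposition7p12 (R : realType) (n p : nat) (hp : (1 <= p)%N)
    (X : calibratedManifold R n p) (f : X -> R)
    (f_analytic : analytic_fun f)
    (f_ge0 : forall x : X, 0 <= f x)
    (f_psh : forall x : X, f x = 0 -> strictly_phi_psh f x)
    (S : set (set X))
    (hS : stratification [set x : X | f x = 0] S)
    (M : set X) (hM : S M) :
  phi_free M.
Proof.
move=> [x [xi [Mx plane_xi tan_xi]]].
have MZ z : M z -> f z = 0.
  move=> Mz; have [SZ _ _ _] := hS.
  by have : (\bigcup_(N in S) N) z by [exists M]; rewrite SZ.
have := f_psh x (MZ x Mx) xi plane_xi.
rewrite /phi_hessian big1 ?ltxx// => i _.
apply: (alternating_row0 _ _ i); first exact: (cal_smooth X).1.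
rewrite rowK eqxx; apply: levi_civita_gradient_eq0 => //.
- exact: cal_riemannian.
- have [gamma [e [e0 gam0 gamM gamS gamD]]] := tan_xi _ (row_sub i xi).
  by exists gamma, e; split=> // t /gamM[/MZ].
Qed.
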